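(* If $S\subset\mathbb N$ is a multiplicatively normal set then any homogeneous system of finitely many polynomial equations (with several variables) which is solvable in $\mathbb N$ is solvable in $S$ (i.e., has a solution with all variables in $S$).
   Context: $\mathbb N=\{1,2,\dots\}$. A homogeneous system is a system $P_1=0,\dots,P_r=0$ where each $P_i$ is a homogeneous polynomial with integer coefficients (Diophantine equations). A set $S\subset\mathbb N$ is multiplicatively normal if it is $(F_n)$-normal for some F{\o}lner sequence $(F_n)$ in $(\mathbb N,\times)$. A F{\o}lner sequence in $(\mathbb N,\times)$ is a sequence $(F_n)$ of (nonempty) finite subsets of $\mathbb N$ with $\lim_n\frac1{|F_n|}|\{h\in F_n:gh\in F_n\}|=1$ for every $g\in\mathbb N$. $S$ is $(F_n)$-normal if for $x=\mathbf 1_S$, every nonempty finite $K\subset\mathbb N$ and every $B\in\{0,1\}^K$, $\lim_n\frac1{|F_n|}|\{g\in\mathbb N:(\forall h\in K)\ hg\in F_n\text{ and }x_{hg}=B(h)\}|=2^{-|K|}$. *)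

(* Defs.v *)
From HB Require Import structures.
From mathcomp Require Import all_boot all_order all_algebra finmap.
From mathcomp Require Import all_classical all_reals all_analysis.
(* The notations of [mpoly] clash with those of [all_analysis]. *)
From mathcomp Require Import -(notations) mpoly.
Set Implicit Arguments.
Unset Strict Implicit.
Unset Printing Implicit Defensive.
Import Order.TTheory GRing.Theory Num.Theory.
Import numFieldNormedType.Exports.
Local Open Scope fset_scope.
Local Open Scope classical_set_scope.
Local Open Scope ring_scope.

(* The set {1, 2, ...}; sets of positive integers are subsets of [nat] that
   are required to lie in [posN]. *)
Definition posN : set nat := [set n | (0 < n)%N].

Definition mul_folner (R : realType) (F : nat -> {fset nat}) : Prop :=
  [/\ forall n, F n != fset0,
      forall n, [set` F n] `<=` posN
    & forall g, posN g ->
        (fun n => #|` [fset h in F n | (g * h)%N \in F n] |%:R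
                  / #|` F n|%:R : R) @ \oo --> (1 : R)].

(* The g > 0 such that, for all h in K, hg is in F and 1_S(hg) = B(h).
   It is finite when K is nonempty and contained in [posN] (there is an
   injection g |-> hg into F), so that its [fset_set] is not a junk value. *)
Definition pattern_set (S : set nat) (F K : {fset nat}) (B : {ffun K -> bool}) :
    set nat :=
  [set g | posN g /\
     forall h : K, (val h * g)%N \in F /\ ((val h * g)%N \in S) = B h].

Definition folner_normal (R : realType) (F : nat -> {fset nat}) (S : set nat) :
    Prop :=
  forall K : {fset nat}, K != fset0 -> [set` K] `<=` posN ->
  forall B : {ffun K -> bool},
    (fun n => #|` fset_set (pattern_set S (F n) B)|%:R / #|` F n|%:R : R)
      @ \oo --> (2 ^- #|` K| : R).

Definition mul_normal (R : realType) (S : set nat) : Prop :=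
  exists F : nat -> {fset nat}, mul_folner R F /\ folner_normal R F S.

(* The degree may depend on the equation. *)
Definition homogeneous_system (r n : nat) (P : 'I_r -> mpoly n int) : Prop :=
  forall j, exists d : nat, P j \is ishomog1 d mdeg.

Definition solvable_in (A : set nat) (r n : nat) (P : 'I_r -> mpoly n int) :
    Prop :=
  exists x : 'I_n -> nat,
    (forall i, A (x i)) /\ forall j, meval (fun i => (x i)%:Z) (P j) = 0.

(* Main.v *)
Require Import Defs.
From mathcomp Require Import all_boot all_order all_algebra finmap.
From mathcomp Require Import all_classical all_reals all_analysis.
From mathcomp Require Import -(notations) mpoly.
Import GRing.Theory Num.Theory.
Local Open Scope classical_set_scope.

(** Solutions of a homogeneous system can be dilated: if [x] is a solution,
    so is [g * x] for every [g].  It therefore suffices to move the finite set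
    [K] of values of a solution into [S] by one multiplication, that is, to
    find [g] with [g * K] contained in [S].  Normality does this: the elements
    [g] for which the indicator of [S] is constantly 1 on [g * K] have density
    [2 ^- #|K|], which is positive, so they exist
    ([folner_normal_dilate_fset]).  Homogeneity of the equations then gives
    the dilated solution ([dhomog_meval_scale]). *)

Lemma dhomog_meval_scale (A : comNzRingType) (n d : nat) (p : mpoly n A)
    (c : A) (v : 'I_n -> A) :
  p \is ishomog1 d mdeg ->
  meval (fun i => c * v i)%R p = (c ^+ d * meval v p)%R.
Proof.
move=> /dhomogP hp; rewrite !mevalE big_distrr /=.
apply: eq_big_seq => m /hp dm.
under eq_bigr do rewrite exprMn.
by rewrite big_split /= -expr_sum -mdegE dm mulrCA.
Qed.

(** A pattern whose limiting frequency is nonzero must occur along the Folner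
    sequence. *)
Lemma folner_normal_pattern {R : realType} {F : nat -> {fset nat}}
    {S : set nat} (hF : folner_normal R F S) {K : {fset nat}}
    (B : {ffun K -> bool}) :
  K != fset0 -> [set` K] `<=` posN -> exists n, pattern_set S (F n) B !=set0.
Proof.
move=> K0 Kpos; have lim := hF K K0 Kpos B.
have lim0 : (2 ^- #|` K| != 0 :> R)%R by rewrite invr_eq0 expf_neq0.
have [N _ /(_ N (leqnn N)) freqN] := cvgr_neq0 _ lim lim0.
exists N; apply/set0P; apply: contra_neq freqN => ->.
by rewrite fset_set0 cardfs0 mul0r.
Qed.

Lemma folner_normal_dilate_fset {R : realType} {F : nat -> {fset nat}}
    {S : set nat} (hF : folner_normal R F S) (K : {fset nat}) :
  [set` K] `<=` posN -> exists g, forall h, h \in K -> S (g * h)%N.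
Proof.
(* For empty [K], where normality is silent, any dilation will do. *)
have [-> _|K0 Kpos] := eqVneq K fset0; first by exists 1%N.
have [n [g [_ hg]]] := folner_normal_pattern hF [ffun=> true] K0 Kpos.
exists g => h hK; have [_] := hg [` hK]%fset.
by rewrite ffunE /= mulnC => /set_mem.
Qed.

Theorem theorem7p3 (R : realType) (S : set nat) (hS : S `<=` posN)
    (hnormal : mul_normal R S) (r n : nat) (P : 'I_r -> mpoly n int)
    (hP : homogeneous_system P) (hsol : solvable_in posN P) :
  solvable_in S P.
Proof.
have [F [_ hF]] := hnormal; have [x [xpos xsol]] := hsol.
have [|g hg] := folner_normal_dilate_fset hF [fset x i | i : 'I_n]%fset.
  by move=> _ /imfsetP[i _ ->]; exact: xpos.
exists (fun i => g * x i)%N; split=> [i|j].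
  by apply: hg; apply/imfsetP; exists i.
have [d hd] := hP j.
under meval_eq do rewrite PoszM.
by rewrite (dhomog_meval_scale _ _ _ _ _ _ hd) xsol mulr0.
Qed.
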